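(* Let $\bar P\in\mathcal{W}([n],\mathcal{D})$ with stationary distribution $\bar\pi=\left(\frac{p_1}{m},\dots,\frac{p_n}{m}\right)$ for $m\in\mathbb{N}$ and $p_1,\dots,p_n\in\mathbb{N}$ with $\sum_{i=1}^np_i=m$. Then there exist a lumping function $\kappa\colon[m]\to[n]$ and a memoryless Markov embedding $L_\star$ (with associated lumping $\kappa$) such that $$L_\star\bar P\in\mathcal{W}_{\mathsf{bis}}([m],\mathcal{E}),\qquad\text{where }\mathcal{E}=\{(y,y')\in[m]^2\colon(\kappa(y),\kappa(y'))\in\mathcal{D}\}.$$
   Context: $[n]=\{1,\dots,n\}$, $n\ge2$, and $([n],\mathcal{D})$ is a strongly connected digraph. For a strongly connected digraph $(\mathcal{Y},\mathcal{E})$, $\mathcal{W}(\mathcal{Y},\mathcal{E})$ is the set of row-stochastic matrices on $\mathcal{Y}$ strictly positive on $\mathcal{E}$ and zero outside; $\mathcal{W}_{\mathsf{bis}}(\mathcal{Y},\mathcal{E})$ is the subset of doubly stochastic matrices (columns also sum to $1$). A lumping function is a surjective map. Memoryless Markov embedding $L_\star\colon\mathcal{W}(\mathcal{X},\mathcal{D})\to\mathcal{W}(\mathcal{Y},\mathcal{E})$ with associated lumping $\kappa\colon\mathcal{Y}\to\mathcal{X}$: here $\{(\kappa(y),\kappa(y')):(y,y')\in\mathcal{E}\}=\mathcal{D}$, and there is $L\colon\mathcal{Y}\to\mathbb{R}$ such that the matrix $\Lambda(y,y')=L(y')$ if $(\kappa(y),\kappa(y'))\in\mathcal{D}$ and $0$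 otherwise, is strictly positive on $\mathcal{E}$ and zero outside $\mathcal{E}$, and $(\Lambda(y,y'))_{y'\in\kappa^{-1}(x')}$ is a probability distribution on $\kappa^{-1}(x')$ whenever $(\kappa(y),x')\in\mathcal{D}$; the embedding is $L_\star\bar P(y,y')=\bar P(\kappa(y),\kappa(y'))L(y')$. *)

(* Defs.v *)
From HB Require Import structures.
From mathcomp Require Import all_boot all_order all_algebra.

Set Implicit Arguments.
Unset Strict Implicit.
Unset Printing Implicit Defensive.

Import Order.TTheory GRing.Theory Num.Theory.
Local Open Scope ring_scope.

(* [connect] also contains the empty path; on at least two vertices (and on a
   single vertex carrying a loop) this does not affect strong connectivity. *)
Definition strongly_connected (T : finType) (E : rel T) : Prop :=
  forall x y : T, connect E x y.

Definition row_stochastic (R : realFieldType) (k : nat) (P : 'M[R]_k) : Prop :=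
  (forall i j, 0 <= P i j) /\ (forall i, \sum_j P i j = 1).

Definition positive_exactly_on (R : realFieldType) (k : nat) (E : rel 'I_k)
    (P : 'M[R]_k) : Prop :=
  (forall i j, E i j -> 0 < P i j) /\ (forall i j, ~~ E i j -> P i j = 0).

Definition W (R : realFieldType) (k : nat) (E : rel 'I_k)
    (P : 'M[R]_k) : Prop :=
  row_stochastic P /\ positive_exactly_on E P.

Definition Wbis (R : realFieldType) (k : nat) (E : rel 'I_k)
    (P : 'M[R]_k) : Prop :=
  W E P /\ (forall j, \sum_i P i j = 1).

Definition stationary_distribution (R : realFieldType) (k : nat)
    (pi : 'rV[R]_k) (P : 'M[R]_k) : Prop :=
  [/\ forall i, 0 <= pi 0 i, \sum_i pi 0 i = 1 & pi *m P = pi].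

Definition lumping (X Y : finType) (kappa : Y -> X) : Prop :=
  forall x : X, exists y : Y, kappa y = x.

Definition memoryless_Lambda (R : realFieldType) (n m : nat) (D : rel 'I_n)
    (kappa : 'I_m -> 'I_n) (L : 'I_m -> R) : 'M[R]_m :=
  \matrix_(y, y') (if D (kappa y) (kappa y') then L y' else 0).

(* [Lstar] is a map from W D to W E: it is a total function on matrices of
   which only the restriction to W D is constrained. *)
Definition memoryless_embedding (R : realFieldType) (n m : nat)
    (D : rel 'I_n) (E : rel 'I_m) (kappa : 'I_m -> 'I_n)
    (Lstar : 'M[R]_n -> 'M[R]_m) : Prop :=
  [/\ strongly_connected D, strongly_connected E & lumping kappa] /\
  (forall x x', D x x' <->
     exists y y', [/\ E y y', kappa y = x & kappa y' = x']) /\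
  (forall P, W D P -> W E (Lstar P)) /\
  exists L : 'I_m -> R,
    let Lambda := memoryless_Lambda D kappa L in
    [/\ positive_exactly_on E Lambda,
        forall y x', D (kappa y) x' ->
          (forall y', kappa y' = x' -> 0 <= Lambda y y') /\
          \sum_(y' | kappa y' == x') Lambda y y' = 1
      & forall P, W D P -> forall y y',
          Lstar P y y' = P (kappa y) (kappa y') * L y'].

(* Main.v *)
Require Import Defs.
From HB Require Import structures.
From mathcomp Require Import all_boot all_order all_algebra.

Set Implicit Arguments.
Unset Strict Implicit.
Unset Printing Implicit Defensive.

Import Order.TTheory GRing.Theory Num.Theory.
Local Open Scope ring_scope.

(* Split each state i into p_i copies that share its mass equally, so
   L(y) = 1 / p_(kappa y). The stationary distribution of the lifted chain is
   then uniform: the column sum at a copy of j is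
   (\sum_i p_i P(i, j)) / p_j = 1. No fibre is empty, because the support of a
   stationary distribution is closed under the edges of D, which is strongly
   connected. *)

(** The disjoint union of the ['I_(p i)] has [m] elements; number them by ['I_m] and project each to
    its index. *)
Lemma exists_map_card_fibers (I : finType) (p : I -> nat) (m : nat) :
  (\sum_i p i = m)%N ->
  exists f : 'I_m -> I, forall i, #|[pred y | f y == i]| = p i.
Proof.
move=> <-; pose T := {i : I & 'I_(p i)}.
have cT : #|{: T}| = (\sum_i p i)%N.
  rewrite card_tagged sumnE big_map big_enum.
  by apply: eq_bigr => i _; rewrite card_ord.
exists (fun y => tag (enum_val (cast_ord (esym cT) y))) => i.
(* [g] sends the [p i] elements of block [i] to their numbers; it is injective, and its image is
   shown to be the fibre over [i]. *)
pose g (k : 'I_(p i)) := cast_ord cT (enum_rank (Tagged (fun i => 'I_(p i)) k)).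
have g_inj : injective g.
  by move=> k k' /cast_ord_inj/enum_rank_inj/eqP; rewrite eq_Tagged => /eqP.
rewrite -[RHS]card_ord -(card_image g_inj).
apply: eq_card => y; rewrite !inE; apply/eqP/imageP.
  case def_y: (enum_val _) => [j k] /= eq_ji.
  (* The type of [g] depends on [i], so [g] is generalized with its body before [i] is replaced by
     [j]. *)
  case: _ / eq_ji @g {g_inj} => g; exists k => //.
  have -> : g k = cast_ord cT (enum_rank (enum_val (cast_ord (esym cT) y))).
    by rewrite def_y.
  by rewrite enum_valK cast_ordKV.
by case=> k _ -> /=; rewrite /g cast_ordK enum_rankK.
Qed.

(** A nonempty path in [D] lifts through arbitrary preimages of its inner vertices, with both
    endpoints prescribed. *)
Lemma strongly_connected_relpre (X Y : finType) (D : rel X) (kappa : Y -> X) :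
  strongly_connected D -> (forall x, exists x', D x x') -> lumping kappa ->
  strongly_connected (relpre kappa D).
Proof.
(* A first edge is forced: if [y] and [y'] are distinct in one fibre, the empty path below would not
   lift. *)
move=> scD outD surj y y'; have [w Dyw] := outD (kappa y).
have /connectP[q qP lastq] := scD w (kappa y').
elim: q => [|v q IHq] /= in y w Dyw qP lastq *.
  by apply: connect1; rewrite /= lastq.
case/andP: qP => Dwv qP; have [z def_w] := surj w.
apply: (@connect_trans _ _ z); first by apply: connect1; rewrite /= def_w.
by apply: (IHq z v) => //; rewrite def_w.
Qed.

Lemma W_out_edge (R : realFieldType) (n : nat) (D : rel 'I_n) (P : 'M[R]_n) :
  W D P -> forall x, exists x', D x x'.
Proof.
case=> -[_ rowP] [_ P0] x; apply/existsP; apply: contraT.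
rewrite negb_exists => /forallP noD.
have := rowP x; rewrite big1 => [/eqP|x' _]; last exact: P0.
by rewrite eq_sym oner_eq0.
Qed.

Lemma stationary_distribution_gt0 (R : realFieldType) (n : nat) (D : rel 'I_n)
    (P : 'M[R]_n) (pi : 'rV[R]_n) :
  strongly_connected D -> W D P -> stationary_distribution pi P ->
  forall i, 0 < pi 0 i.
Proof.
move=> scD [[P_ge0 _] [P_gt0 _]] [pi_ge0 pi_sum pi_stat] j.
have step i k : D i k -> 0 < pi 0 i -> 0 < pi 0 k.
  move=> Dik pi_i; rewrite -pi_stat mxE (bigD1 i) //=.
  apply: ltr_pwDl; first by rewrite mulr_gt0 ?P_gt0.
  by apply: sumr_ge0 => l _; rewrite mulr_ge0.
have [i pi_i] : exists i, 0 < pi 0 i.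
  apply/existsP; apply: contraT; rewrite negb_exists => /forallP pi_le0.
  have := pi_sum; rewrite big1 => [/eqP|i _]; first by rewrite eq_sym oner_eq0.
  by apply: le_anti; rewrite pi_ge0 leNgt pi_le0.
have /connectP[q qP ->] := scD i j.
by elim: q => //= k q IHq in i pi_i qP *; case/andP: qP => /step/(_ pi_i) /IHq.
Qed.

Lemma sum_fibers (R : pzSemiRingType) (X Y : finType) (kappa : Y -> X)
    (F : X -> R) :
  \sum_y F (kappa y) = \sum_x F x *+ #|[pred y | kappa y == x]|.
Proof.
rewrite (partition_big kappa predT) //=; apply: eq_bigr => x _.
by rewrite -sumr_const; apply: eq_bigr => y /eqP ->.
Qed.

Theorem corollary4p2 (R : realFieldType) (n : nat) (hn : (2 <= n)%N)
    (D : rel 'I_n) (hD : strongly_connected D)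
    (Pbar : 'M[R]_n) (hP : W D Pbar)
    (m : nat) (p : 'I_n -> nat) (hp : (\sum_i p i = m)%N)
    (hpi : stationary_distribution (\row_i ((p i)%:R / m%:R)) Pbar) :
  exists (kappa : 'I_m -> 'I_n) (Lstar : 'M[R]_n -> 'M[R]_m),
    [/\ lumping kappa,
        memoryless_embedding D (relpre kappa D) kappa Lstar
      & Wbis (relpre kappa D) (Lstar Pbar)].
Proof.
have pi_gt0 i : 0 < (p i)%:R / m%:R :> R.
  by have := stationary_distribution_gt0 hD hP hpi i; rewrite mxE.
(* Since the inverse of 0 is 0, [m = 0] would make every stationary mass vanish. *)
have m_neq0 : m%:R != 0 :> R.
  apply/eqP=> m0; have := pi_gt0 (Ordinal (ltnW hn)).
  by rewrite m0 invr0 mulr0 ltxx.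
have p_gt0 i : (0 < p i)%N.
  by rewrite lt0n; apply/eqP=> p0; have := pi_gt0 i; rewrite p0 mul0r ltxx.
have p_neq0 i : (p i)%:R != 0 :> R by rewrite pnatr_eq0 -lt0n.
have [kappa card_kappa] := exists_map_card_fibers hp.
pose L y : R := (p (kappa y))%:R^-1.
have L_gt0 y : 0 < L y by rewrite invr_gt0 ltr0n.
pose Lstar (P : 'M[R]_n) : 'M[R]_m :=
  \matrix_(y, y') (P (kappa y) (kappa y') * L y').
have surj : lumping kappa.
  move=> x; have := p_gt0 x; rewrite -card_kappa => /card_gt0P[y /eqP <-].
  by exists y.
have WL P : W D P -> W (relpre kappa D) (Lstar P).
  move=> [[P_ge0 rowP] [P_gt0 P0]]; split; split.
  - by move=> y y'; rewrite mxE mulr_ge0 ?P_ge0 ?ltW.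
  - move=> y; under eq_bigr do rewrite mxE.
    (* The [p x] copies of [x] each contribute [P (kappa y) x / p x], so the row sum of [P]
       reappears. *)
    rewrite (sum_fibers kappa (fun x => P (kappa y) x / (p x)%:R)).
    rewrite -[RHS](rowP (kappa y)); apply: eq_bigr => x _.
    by rewrite card_kappa -mulr_natr divfK.
  - by move=> y y' Dyy'; rewrite mxE mulr_gt0 ?P_gt0.
  - by move=> y y' Dyy'; rewrite mxE P0 ?mul0r.
exists kappa, Lstar; split=> //.
- split; first by split=> //; apply: strongly_connected_relpre (W_out_edge hP) _.
  split.
    move=> x x'; split=> [Dxx'|[y [y' [Dyy' <- <-]]]//].
    have [[y def_x] [y' def_x']] := (surj x, surj x').
    by exists y, y'; rewrite /= def_x def_x'.
  split=> //; exists L; split=> [|y x' Dyx'|P _ y y']; last by rewrite mxE.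
    by split=> y y' /=; rewrite mxE; case: ifP.
  split=> [y' def_x'|]; first by rewrite mxE; case: ifP => // _; apply: ltW.
  rewrite (eq_bigr (fun=> (p x')%:R^-1)) => [|y' /eqP def_x'].
    by rewrite sumr_const card_kappa -[_^-1 *+ _]mulr_natr mulVf.
  by rewrite mxE def_x' Dyx' /L def_x'.
- split=> [|y']; first exact: WL.
  under eq_bigr do rewrite mxE.
  rewrite -mulr_suml (sum_fibers kappa (fun x => Pbar x (kappa y'))).
  case: hpi => _ _ /matrixP/(_ 0 (kappa y')); rewrite !mxE => stat.
  (* Scaling by [p (kappa y') / m] turns the column sum into the stationarity equation at
     [kappa y']. *)
  apply: (mulIf (p_neq0 (kappa y'))); rewrite mul1r divfK //.
  apply: (mulIf (invr_neq0 m_neq0)); rewrite -stat mulr_suml.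
  by apply: eq_bigr => x _; rewrite mxE card_kappa -mulr_natl mulrAC.
Qed.
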